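(* Let $n\ge 2$. For all real $s_{11},s_{12},s_{22}$ with $s_{11},s_{22}\ge 0$ and $s_{12}^2\le s_{11}s_{22}$, the joint moment generating function $$\phi_n(s_{11},s_{12},s_{22}) := E\left[\exp\left\{-\tfrac12\left(s_{11}Z_{11}^n+2s_{12}Z_{12}^n+s_{22}Z_{22}^n\right)\right\}\right]$$ is given by $$\phi_n(s_{11},s_{12},s_{22})=\left(d_n(\alpha)\,d_n(\beta)\right)^{-1/2},$$ where $$\alpha=-\frac{s_{11}+s_{22}+\sqrt{(s_{11}-s_{22})^2+4s_{12}^2}}{2},\qquad \beta=-\frac{s_{11}+s_{22}-\sqrt{(s_{11}-s_{22})^2+4s_{12}^2}}{2}.$$
   Context: $\{X_k\}_{k\ge1}$ and $\{Y_k\}_{k\ge1}$ are two independent sequences of independent standard Gaussian random variables; $S_i=\sum_{j=1}^i X_j$ and $T_i=\sum_{j=1}^i Y_j$. For $n\ge2$, $$Z_{11}^n=\frac1n\sum_{i=1}^n S_i^2-\frac1{n^2}\Big(\sum_{i=1}^n S_i\Big)^2,\quad Z_{22}^n=\frac1n\sum_{i=1}^n T_i^2-\frac1{n^2}\Big(\sum_{i=1}^n T_i\Big)^2,$$ $$Z_{12}^n=\frac1n\sum_{i=1}^n S_iT_i-\frac1{n^2}\Big(\sum_{i=1}^n S_i\Big)\Big(\sum_{i=1}^n T_i\Big).$$ $K_n$ is the $(n-1)\times(n-1)$ symmetric matrix with entries $K_n(j,k)=\min(j,k)/n-jk/n^2$, $1\le j,k\le n-1$, and $d_n(\lambda)=\det(I_{n-1}-\lambda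 K_n)$, where $I_{n-1}$ is the identity matrix. *)

(* Defs.v *)
From HB Require Import structures.
From mathcomp Require Export all_boot all_order all_algebra finmap.
From mathcomp Require Export all_classical all_reals all_analysis.

Set Implicit Arguments.
Unset Strict Implicit.
Unset Printing Implicit Defensive.

Export Order.TTheory GRing.Theory Num.Theory.
Export numFieldNormedType.Exports.

Local Open Scope classical_set_scope.
Local Open Scope ring_scope.

(* Equality of laws is tested on measurable sets only: [pushforward] and
   [normal_prob] are total set functions with arbitrary values elsewhere.
   The second parameter of [normal_prob] is the standard deviation. *)
Definition std_gaussian d (T : measurableType d) (R : realType)
    (P : probability T R) (X : {RV P >-> R}) : Prop :=
  forall B : set R, measurable B -> distribution P X B = normal_prob 0 1 B.

Definition mutually_independent d (T : measurableType d) (R : realType)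
    (P : probability T R) (X : nat -> {RV P >-> R}) : Prop :=
  forall (J : {fset nat}) (B : nat -> set R), (forall k, measurable (B k)) ->
    P (\bigcap_(k in [set` J]) (X k @^-1` B k)) =
    (\prod_(k <- J) P (X k @^-1` B k))%E.

(* The sigma-algebra on [T] generated by the whole sequence [X]. *)
Definition sigma_seq d (T : measurableType d) (R : realType)
    (P : probability T R) (X : nat -> {RV P >-> R}) : set (set T) :=
  <<s \bigcup_k preimage_set_system setT (X k) measurable >>.

Definition independent_sequences d (T : measurableType d) (R : realType)
    (P : probability T R) (X Y : nat -> {RV P >-> R}) : Prop :=
  forall A B : set T, sigma_seq X A -> sigma_seq Y B ->
    P (A `&` B) = (P A * P B)%E.

(* Sequences are 0-based: [X j] stands for X_{j+1}, so that
   [partial_sum X i] = X_1 + ... + X_i. *)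
Definition partial_sum d (T : measurableType d) (R : realType)
    (P : probability T R) (X : nat -> {RV P >-> R}) (i : nat) (w : T) : R :=
  \sum_(j < i) X j w.

(* Z_11^n, Z_12^n and Z_22^n are [Zstat n X X], [Zstat n X Y], [Zstat n Y Y]. *)
Definition Zstat d (T : measurableType d) (R : realType)
    (P : probability T R) (n : nat) (X Y : nat -> {RV P >-> R}) (w : T) : R :=
  n%:R^-1 * (\sum_(1 <= i < n.+1) partial_sum X i w * partial_sum Y i w)
  - (n%:R ^+ 2)^-1 * ((\sum_(1 <= i < n.+1) partial_sum X i w)
                      * (\sum_(1 <= i < n.+1) partial_sum Y i w)).

Definition phi d (T : measurableType d) (R : realType) (P : probability T R)
    (n : nat) (X Y : nat -> {RV P >-> R}) (s11 s12 s22 : R) : \bar R :=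
  ('E_P[fun w : T => expR (- 2^-1 * (s11 * Zstat n X X w
                                     + 2 * s12 * Zstat n X Y w
                                     + s22 * Zstat n Y Y w))])%E.

(* Indices of ['I_n.-1] are 0-based, hence the successors. *)
Definition Kmx (R : realType) (n : nat) : 'M[R]_n.-1 :=
  \matrix_(j, k) ((minn j.+1 k.+1)%:R / n%:R
                  - j.+1%:R * k.+1%:R / n%:R ^+ 2).

Definition dn (R : realType) (n : nat) (lambda : R) : R :=
  \det (1%:M - lambda *: Kmx R n).

Definition alpha (R : realType) (s11 s12 s22 : R) : R :=
  - ((s11 + s22 + Num.sqrt ((s11 - s22) ^+ 2 + 4 * s12 ^+ 2)) / 2).

Definition beta (R : realType) (s11 s12 s22 : R) : R :=
  - ((s11 + s22 - Num.sqrt ((s11 - s22) ^+ 2 + 4 * s12 ^+ 2)) / 2).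

(* Main.v *)
(* The statistics depend on X_2, ..., X_n and Y_2, ..., Y_n only:
   Z_12 = x^T K_n y with x = (X_2, ..., X_n) and y = (Y_2, ..., Y_n), and
   similarly for Z_11 and Z_22. The exponent is therefore -1/2 times the
   quadratic form of S (x) K_n, S = [[s11, s12], [s12, s22]], evaluated at a
   vector of independent standard Gaussians. For A positive definite,
   E exp (- 1/2 z^T (A - I) z) = det(A)^(-1/2): integrate out one coordinate
   at a time, each integration replacing A by a Schur complement. Finally
   det(I + S (x) K_n) is the determinant of four commuting blocks, and
   (I - alpha K_n)(I - beta K_n) =
   (I + s11 K_n)(I + s22 K_n) - s12^2 K_n^2. *)
From HB Require Import structures.
Require Import Defs.
From mathcomp Require Import measurable_realfun zify ring.

Set Implicit Arguments.
Unset Strict Implicit.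
Unset Printing Implicit Defensive.

Local Open Scope classical_set_scope.
Local Open Scope ring_scope.

(** * Gaussian integrals and independence *)

Section gaussian_integral.
Context {R : realType}.
Local Notation mu := (@lebesgue_measure R).

(** The normal law is dominated by Lebesgue measure, and [normal_pdf] equals its Radon-Nikodym
    derivative almost everywhere because both have the same integral over every measurable set. *)
Lemma ge0_integral_normal_prob (m s : R) (f : R -> \bar R) :
  measurable_fun setT f -> (forall x, 0 <= f x)%E ->
  (\int[normal_prob m s]_x f x = \int[mu]_x (f x * (normal_pdf m s x)%:E))%E.
Proof.
move=> mf f0.
have dom := normal_prob_dominates m s.
rewrite -(Radon_Nikodym_SigmaFinite.change_of_variables dom)//.
have mpdf : measurable_fun setT (fun x => (normal_pdf m s x)%:E).
  by apply/measurable_EFinP; exact: measurable_normal_pdf.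
apply: ae_eq_integral => //.
- apply: emeasurable_funM => //.
  exact: measurable_int (Radon_Nikodym_SigmaFinite.f_integrable dom).
- exact: emeasurable_funM.
- apply: ae_eqe_mul2l; apply: integral_ae_eq => //.
    exact: Radon_Nikodym_SigmaFinite.f_integrable.
  by move=> E _ mE; rewrite -Radon_Nikodym_SigmaFinite.f_integral.
Qed.

Lemma measurable_expR_quadratic (b w : R) : measurable_fun [set: R]
  (fun u => (expR (- 2^-1 * (b * u ^+ 2 + 2 * w * u)))%:E).
Proof.
apply/measurable_EFinP; apply: measurableT_comp => //.
apply: measurable_funM => //; apply: measurable_funD => //.
by apply: measurable_funM => //; exact: measurable_funX.
Qed.

(* The integrand is, up to a constant factor, the density of
   N(- w / a, 1 / a) once multiplied by the standard Gaussian density. *)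
Lemma integral_normal_prob_expR_quadratic (a w : R) : 0 < a ->
  (\int[normal_prob 0 1]_u
     (expR (- 2^-1 * ((a - 1) * u ^+ 2 + 2 * w * u)))%:E =
   (a `^ (- 2^-1) * expR (w ^+ 2 / (2 * a)))%:E)%E.
Proof.
move=> a0.
have s0 : a `^ (- 2^-1) != 0 by rewrite gt_eqF// powR_gt0.
have sE : (a `^ (- 2^-1)) ^+ 2 = a^-1.
  rewrite -powR_mulrn ?powR_ge0// -powRrM mulNr mulVf ?pnatr_eq0//.
  by rewrite powR_inv1 ?ltW.
rewrite ge0_integral_normal_prob; last first.
- by move=> x; rewrite lee_fin expR_ge0.
- exact: measurable_expR_quadratic.
under eq_integral => u _.
  rewrite -EFinM.
  rewrite (_ : expR _ * _ = (a `^ (- 2^-1) * expR (w ^+ 2 / (2 * a))) *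
     normal_pdf (- w / a) (a `^ (- 2^-1)) u); last first.
    rewrite !normal_pdfE ?oner_eq0// /normal_peak /normal_fun sE.
    rewrite expr1n subr0 mul1r.
    have pi0 : 0 < pi *+ 2 :> R by rewrite pmulrn_lgt0// pi_gt0.
    rewrite -mulrnAr sqrtrM ?invr_ge0 ?ltW// -{1}sE sqrtr_sqr.
    rewrite ger0_norm ?powR_ge0//.
    rewrite mulrCA -expRD [RHS]mulrACA (invfM (a `^ _)) (mulrA (a `^ _)).
    rewrite mulfV// mul1r -expRD; congr (_ * expR _).
    by field; rewrite gt_eqF.
  rewrite EFinM; over.
rewrite ge0_integralZl//.
- by rewrite integral_normal_pdf mule1.
- by apply/measurable_EFinP; exact: measurable_normal_pdf.
- by move=> x _; rewrite lee_fin normal_pdf_ge0.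
- by rewrite lee_fin mulr_ge0 ?powR_ge0 ?expR_ge0.
Qed.

End gaussian_integral.

(** * Independence extended from a pi-system to the sigma-algebra it generates *)

Section independent_of_sigma_algebra.
Context d (T : measurableType d) (R : realType) (P : probability T R).
Variables (X : {RV P >-> R}) (G : set (set T)).
Hypotheses (mG : G `<=` measurable) (setIG : setI_closed G) (GT : G setT).
Hypothesis indep : forall A E, measurable A -> G E ->
  P (X @^-1` A `&` E) = (P (X @^-1` A) * P E)%E.

(** As functions of [E], both sides are finite measures: a restriction of [P] and a multiple of [P].
    They agree on the pi-system [G], hence on [<<s G >>]. *)
Lemma independent_g_sigma_algebra A E : measurable A -> <<s G >> E ->
  P (X @^-1` A `&` E) = (P (X @^-1` A) * P E)%E.
Proof.
move=> mA sE.
have mXA : measurable (X @^-1` A).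
  by rewrite -[_ @^-1` _]setTI; exact: measurable_funPT.
have finXA : P (X @^-1` A) \is a fin_num by exact: fin_num_measure.
pose c : {nonneg R} := NngNum (fine_ge0 (measure_ge0 P (X @^-1` A))).
have H : <<s G >> E -> mrestr P mXA E = mscale c P E.
  apply: (g_sigma_algebra_measure_unique G mG (fun=> setT)) => //.
  - by rewrite bigcup_const.
  - move=> B GB; rewrite -[LHS]/(P (B `&` X @^-1` A)) setIC indep//.
    by rewrite -[RHS]/(c%:num%:E * P B)%E /c /= fineK.
  - by move=> _; rewrite -[ltLHS]/(P (setT `&` _)) setTI ltey_eq finXA.
by rewrite setIC [LHS](H sE) -[LHS]/(c%:num%:E * P E)%E /c /= fineK.
Qed.

(* Fubini for the joint law of [X] and of the identity map of [T], the latter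
   seen as a random variable with values in [T] endowed with [<<s G >>]. *)
Lemma integral_independent (F : R * g_sigma_algebraType G -> \bar R) :
  measurable_fun setT F -> (forall z, 0 <= F z)%E ->
  (\int[P]_w F (X w, w) = \int[P]_w \int[distribution P X]_u F (u, w))%E.
Proof.
move=> mF F0.
have sGm : <<s G >> `<=` @measurable _ T.
  exact: smallest_sub (@sigma_algebra_measurable _ T) mG.
have mid : measurable_fun setT (id : T -> g_sigma_algebraType G).
  by move=> _ B mB; rewrite setTI; exact: sGm.
have mj : measurable_fun setT (fun w => (X w, w) : R * g_sigma_algebraType G).
  exact: measurable_fun_pair.
pose J : {mfun T >-> (R * g_sigma_algebraType G)%type} :=
  HB.pack (fun w : T => (X w, w) : R * g_sigma_algebraType G)
    (isMeasurableFun.Build _ _ _ _ _ mj).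
pose I : {mfun T >-> g_sigma_algebraType G} :=
  HB.pack (id : T -> g_sigma_algebraType G)
    (isMeasurableFun.Build _ _ _ _ _ mid).
transitivity (\int[distribution P J]_z F z)%E.
  by rewrite ge0_integral_distribution.
(* The joint law is the product law, since the two agree on rectangles. *)
transitivity (\int[distribution P X \x distribution P I]_z F z)%E.
  apply: eq_measure_integral => A mA _; apply/esym.
  apply: product_measure_unique => // B C mB mC.
  exact: independent_g_sigma_algebra.
rewrite fubini_tonelli2// ge0_integral_distribution//.
- exact: measurable_fun_fubini_tonelli_G.
- by move=> y; exact: integral_ge0.
Qed.

End independent_of_sigma_algebra.

(** * Quadratic forms and Schur complements *)

Section quadratic_forms.
Context {R : realFieldType}.

Definition qform m (A : 'M[R]_m) (x : 'cV[R]_m) : R := (x^T *m A *m x) 0 0.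

Definition posdef m (A : 'M[R]_m) : Prop :=
  A^T = A /\ forall x, x != 0 -> 0 < qform A x.

Lemma qformD m (A B : 'M[R]_m) x : qform (A + B) x = qform A x + qform B x.
Proof. by rewrite /qform mulmxDr mulmxDl mxE. Qed.

Lemma qformN m (A : 'M[R]_m) x : qform (- A) x = - qform A x.
Proof. by rewrite /qform mulmxN mulNmx mxE. Qed.

Lemma qform1_ge0 m (x : 'cV[R]_m) : 0 <= qform 1%:M x.
Proof.
rewrite /qform mulmx1 mxE; apply: sumr_ge0 => i _.
by rewrite mxE -expr2 sqr_ge0.
Qed.

Lemma qform1_gt0 m (x : 'cV[R]_m) : x != 0 -> 0 < qform 1%:M x.
Proof.
move=> x0; rewrite lt_def qform1_ge0 andbT; apply: contra_neq x0 => qx0.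
apply/colP => i; rewrite mxE; apply/eqP; rewrite -sqrf_eq0; apply/eqP.
move: qx0; rewrite /qform mulmx1 mxE => /psumr_eq0P H.
have := H _ i isT; rewrite mxE -expr2; apply => j _.
by rewrite mxE -expr2 sqr_ge0.
Qed.

Lemma posdef_add1 m (A : 'M[R]_m) :
  A^T = A -> (forall x, 0 <= qform A x) -> posdef (1%:M + A).
Proof.
move=> At A0; split; first by rewrite linearD/= trmx1 At.
by move=> x x0; rewrite qformD ltr_pwDl// qform1_gt0.
Qed.

(** The transpose stands for the upper right block, so this is the Schur complement of the entry
    [A 0 0] when [A] is symmetric. *)
Definition schur m (A : 'M[R]_(1 + m)) : 'M[R]_m :=
  drsubmx A - (A 0 0)^-1 *: (dlsubmx A *m (dlsubmx A)^T).

(** Isolates the first coordinate as a quadratic polynomial in [u], the shape of the one-dimensional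
    Gaussian integral. *)
Lemma qform_col_mx m (A : 'M[R]_(1 + m)) u (y : 'cV[R]_m) : A^T = A ->
  qform A (col_mx u%:M y) =
  A 0 0 * u ^+ 2 + 2 * ((dlsubmx A)^T *m y) 0 0 * u + qform (drsubmx A) y.
Proof.
move=> At; have ur : ursubmx A = (dlsubmx A)^T by rewrite trmx_dlsub At.
set c := dlsubmx A.
have e00 : ulsubmx A = (A 0 0)%:M.
  by rewrite [LHS]mx11_scalar !mxE; congr (A _ _)%:M; exact/val_inj.
rewrite /qform -[A in LHS]submxK ur e00 tr_col_mx -/c.
have cy : (y^T *m c) 0 0 = (c^T *m y) 0 0.
  by rewrite -[y^T *m c]trmxK mxE trmx_mul trmxK.
rewrite mul_row_block mul_row_col !mulmxDl tr_scalar_mx.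
rewrite !mul_scalar_mx !mul_mx_scalar -scalemxAl -?scalemxAr.
move: cy; move: (y^T *m c) (c^T *m y) (y^T *m drsubmx A *m y) => p q r.
move=> cy; rewrite !mxE cy !mulr1n; ring.
Qed.

Lemma qform_schur m (A : 'M[R]_(1 + m)) (y : 'cV[R]_m) :
  qform (schur A) y =
  qform (drsubmx A) y - (A 0 0)^-1 * (((dlsubmx A)^T *m y) 0 0) ^+ 2.
Proof.
rewrite qformD qformN; congr (_ - _); set c := dlsubmx A.
have cy : (y^T *m c) 0 0 = (c^T *m y) 0 0.
  by rewrite -[y^T *m c]trmxK mxE trmx_mul trmxK.
rewrite /qform -scalemxAr -scalemxAl mxE mulmxA -(mulmxA (y^T *m c)).
by rewrite mxE big_ord1 cy expr2.
Qed.

Lemma posdef00_gt0 m (A : 'M[R]_(1 + m)) : posdef A -> 0 < A 0 0.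
Proof.
case=> At /(_ (col_mx 1%:M 0)); rewrite qform_col_mx//.
rewrite mulmx0 /qform mulmx0 !mxE mulr0 mul0r !addr0 expr1n mulr1; apply.
by apply/eqP => /matrixP/(_ 0 0)/eqP; rewrite mxE; case: splitP => // j _;
  rewrite !mxE (ord1 j) oner_eq0.
Qed.

Lemma posdef_schur m (A : 'M[R]_(1 + m)) : posdef A -> posdef (schur A).
Proof.
move=> pA; have a0 := posdef00_gt0 pA; case: pA => At pA; split.
  by rewrite /schur linearB linearZ/= trmx_mul trmxK trmx_drsub At.
move=> y y0; rewrite qform_schur; set t := (_ *m y) 0 0.
(* This first coordinate minimises the form of [A] for fixed [y]; the minimum is the form of the
   Schur complement at [y]. *)
have /pA : col_mx (- (t / A 0 0))%:M y != 0.
  by apply: contra_neq y0 => /(congr1 dsubmx); rewrite col_mxKd linear0.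
rewrite qform_col_mx// -/t; congr (_ < _); field.
by rewrite gt_eqF.
Qed.

(** Block Gaussian elimination: [A] is a product of a lower and an upper block triangular matrix. *)
Lemma det_schur m (A : 'M[R]_(1 + m)) : A^T = A -> A 0 0 != 0 ->
  \det A = A 0 0 * \det (schur A).
Proof.
move=> At a0; have ur : ursubmx A = (dlsubmx A)^T by rewrite trmx_dlsub At.
have e00 : ulsubmx A = (A 0 0)%:M.
  rewrite [LHS]mx11_scalar !mxE; congr (A _ _)%:M; exact/val_inj.
have AE : A = block_mx (A 0 0)%:M 0 (dlsubmx A) 1%:M *m
              block_mx 1%:M ((A 0 0)^-1 *: (dlsubmx A)^T) 0 (schur A).
  rewrite mulmx_block !mulmx1 !mulmx0 !mul0mx !addr0 mul1mx.
  rewrite mul_scalar_mx scalerA mulfV// scale1r -scalemxAr.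
  by rewrite /schur addrC subrK -e00 -ur submxK.
rewrite [in LHS]AE det_mulmx det_lblock det_ublock !det1 mulr1 mul1r.
by rewrite det_scalar1.
Qed.

Lemma posdef_det_gt0 m (A : 'M[R]_m) : posdef A -> 0 < \det A.
Proof.
elim: m A => [A _|m IHm A pA]; first by rewrite det_mx00.
have a0 := posdef00_gt0 (pA : @posdef (1 + m) A).
rewrite (@det_schur m) ?(proj1 pA) ?gt_eqF// mulr_gt0//.
exact/IHm/posdef_schur.
Qed.

End quadratic_forms.

(** Elimination gives det A det(D - C A^-1 B); multiplying out, commutation turns A C A^-1 B into C
    B. *)
Lemma det_block_comm (F : fieldType) m (A B C D : 'M[F]_m) :
  A \in unitmx -> A *m C = C *m A ->
  \det (block_mx A B C D) = \det (A *m D - C *m B).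
Proof.
move=> uA AC.
have -> : block_mx A B C D =
    block_mx A 0 C 1%:M *m
    block_mx 1%:M (invmx A *m B) 0 (D - C *m invmx A *m B).
  rewrite mulmx_block !mulmx1 !mulmx0 !mul0mx !addr0 mul1mx.
  by rewrite mulKVmx// mulmxA addrC subrK.
rewrite det_mulmx det_lblock det_ublock !det1 mulr1 mul1r -det_mulmx.
by rewrite mulmxBr 2!mulmxA AC mulmxK.
Qed.

(** * Gaussian integrals of quadratic forms in several variables *)

Section gaussian_vector.
Context d (T : measurableType d) (R : realType) (P : probability T R).

(* [R] and [measurableTypeR R] have the same measurable sets but distinct
   displays: [distribution P X] lives on the former, [normal_prob] on the
   latter. *)
Lemma integral_std_gaussian (X : {RV P >-> R}) (f : R -> \bar R) :
  std_gaussian X -> measurable_fun setT f -> (forall x, 0 <= f x)%E ->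
  (\int[distribution P X]_u f u = \int[normal_prob 0 1]_u f u)%E.
Proof.
move=> gX mf f0; rewrite ge0_integral_distribution//.
have mX : measurable_fun setT (X : T -> measurableTypeR R).
  exact: (measurable_funPT X).
pose X' : {mfun T >-> measurableTypeR R} :=
  HB.pack (X : T -> measurableTypeR R) (isMeasurableFun.Build _ _ _ _ _ mX).
rewrite -(@ge0_integral_distribution _ _ _ _ _ P X')//.
by apply: eq_measure_integral => A mA _; exact: gX.
Qed.

(** Subfamilies are covered by taking [B i = setT] for the other indices. *)
Definition fin_mutually_independent m (Z : 'I_m -> {RV P >-> R}) : Prop :=
  forall B : 'I_m -> set R, (forall i, measurable (B i)) ->
    P [set w | forall i, B i (Z i w)] = (\prod_i P (Z i @^-1` B i))%E.

Lemma measurable_mulmx d' (T' : measurableType d') m n p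
    (M : T' -> 'M[R]_(m, n)) (N : T' -> 'M[R]_(n, p)) :
  (forall i j, measurable_fun setT (fun w => M w i j)) ->
  (forall i j, measurable_fun setT (fun w => N w i j)) ->
  forall i j, measurable_fun setT (fun w => (M w *m N w) i j).
Proof.
move=> mM mN i j; under eq_fun do rewrite mxE.
by apply: measurable_sum => k; exact: measurable_funM.
Qed.

Lemma measurable_qform d' (T' : measurableType d') m (C : 'M[R]_m)
    (V : T' -> 'cV[R]_m) :
  (forall i, measurable_fun setT (fun w => V w i 0)) ->
  measurable_fun setT (fun w => qform C (V w)).
Proof.
move=> mV; apply: measurable_mulmx => i j; last by rewrite ord1.
apply: measurable_mulmx => k l; last exact: measurable_cst.
by rewrite (ord1 k); under eq_fun do rewrite mxE; exact: mV.
Qed.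

(** The subtracted identity is the form carried by the Gaussian density. In this shape the statement
    is stable under induction: [schur A] takes the place of [A], and the factors [A 0 0] multiply up
    to the determinant. *)
Lemma integral_gaussian_qform m (Z : 'I_m -> {RV P >-> R}) (A : 'M[R]_m) :
  (forall i, std_gaussian (Z i)) -> fin_mutually_independent Z -> posdef A ->
  (\int[P]_w (expR (- 2^-1 * qform (A - 1%:M) (\col_i Z i w)))%:E =
   (\det A `^ (- 2^-1))%:E)%E.
Proof.
elim: m => [|m IHm] in Z A *.
  move=> _ _ _; rewrite det_mx00 powR1.
  under eq_integral do rewrite /qform mxE big_ord0 mulr0 expR0.
  by rewrite integral_cst// mul1e [LHS]probability_setT.
move=> gZ iZ pA; change 'M[R]_(1 + m) in A.
have a0 := posdef00_gt0 pA; have At : A^T = A by case: pA.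
pose X := Z ord0; pose Y (i : 'I_m) := Z (lift ord0 i).
(* The cylinder sets of the remaining coordinates form a pi-system. *)
pose G : set (set T) := [set E | exists2 B : 'I_m -> set R,
  (forall i, measurable (B i)) & E = [set w | forall i, B i (Y i w)]].
have mG : G `<=` measurable.
  move=> _ [B mB ->]; rewrite (_ : mkset _ = \big[setI/setT]_i (Y i @^-1` B i)).
    apply: bigsetI_measurable => i _.
    by rewrite -[_ @^-1` _]setTI; exact: measurable_funPT.
  apply/seteqP; split => [w Bw|w].
    by elim/big_ind: _ => [|U V ? ?|i _]; [|split|exact: Bw].
  by move=> + i; rewrite (bigD1 i)//= => -[].
have GI : setI_closed G.
  move=> _ _ [B mB ->] [C mC ->].
  exists (fun i => B i `&` C i) => [i|]; first exact: measurableI.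
  apply/seteqP; split=> [w [Bw Cw] i|w BCw].
    by split.
  by split=> i; have [] := BCw i.
have GT : G setT.
  by exists (fun=> setT) => //; apply/seteqP; split.
have jointE U B : measurable U -> (forall i, measurable (B i)) ->
    P (X @^-1` U `&` [set w | forall i, B i (Y i w)]) =
    (P (X @^-1` U) * \prod_i P (Y i @^-1` B i))%E.
  (* [B'] puts [U] at index 0 and [B] at the later indices. *)
  move=> mU mB; pose B' i := oapp B U (unlift ord0 i).
  have mB' i : measurable (B' i) by rewrite /B'; case: unliftP => [j|] _ /=.
  have B'0 : B' ord0 = U by rewrite /B' unlift_none.
  have B'l j : B' (lift ord0 j) = B j by rewrite /B' liftK.
  have := iZ _ mB'; rewrite big_ord_recl B'0.
  under eq_bigr do rewrite B'l.
  move=> <-; congr (P _); apply/seteqP; split => [w [Uw Bw] i|w Bw].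
    by case: (unliftP ord0 i) => [j|] ->; rewrite ?B'0// B'l; exact: Bw.
  by split=> [|j]; [have := Bw ord0; rewrite B'0|
                    have := Bw (lift ord0 j); rewrite B'l].
have YE B : (forall i, measurable (B i)) ->
    P [set w | forall i, B i (Y i w)] = (\prod_i P (Y i @^-1` B i))%E.
  move=> mB; have := jointE setT B measurableT mB.
  by rewrite preimage_setT setTI probability_setT mul1e.
have XG U E : measurable U -> G E ->
  P (X @^-1` U `&` E) = (P (X @^-1` U) * P E)%E.
  by move=> mU [B mB ->]; rewrite YE// jointE.
(* The domain carries the coarser sigma-algebra, as Fubini with [X] split off requires. *)
pose V (w : g_sigma_algebraType G) : 'cV[R]_m := \col_i Y i w.
have mV i j : measurable_fun setT (fun w => V w i j).
  under eq_fun do rewrite mxE.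
  move=> _ U mU; rewrite setTI; apply: sub_sigma_algebra.
  exists (fun k => if k == i then U else setT) => [k|]; first by case: ifP.
  apply/seteqP; split => [w Uw k|w /(_ i)]; last by rewrite eqxx.
  by case: eqP => // ->.
pose W w := ((dlsubmx A)^T *m V w) 0 0.
have mW : measurable_fun setT W.
  by apply: measurable_mulmx => // i j; exact: measurable_cst.
pose F (z : R * g_sigma_algebraType G) := (expR (- 2^-1 *
  ((A 0 0 - 1) * z.1 ^+ 2 + 2 * W z.2 * z.1 +
   qform (drsubmx A - 1%:M) (V z.2))))%:E.
have mF : measurable_fun setT F.
  apply/measurable_EFinP; apply: measurableT_comp => //.
  apply: measurable_funM => //; apply: measurable_funD; last first.
    exact: measurableT_comp (measurable_qform _ (mV^~ 0)) measurable_snd.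
  apply: measurable_funD.
    apply: measurable_funM => //; apply: measurable_funX.
    exact: measurable_fst.
  apply: measurable_funM; last exact: measurable_fst.
  by apply: measurable_funM => //; exact: measurableT_comp mW measurable_snd.
transitivity (\int[P]_w F (X w, w))%E.
  apply: eq_integral => w _; rewrite /F/=; congr (expR (_ * _))%:E.
  have -> : \col_i Z i w = col_mx (X w)%:M (V w) :> 'cV_(1 + m).
    apply/colP => i; rewrite !mxE; case: splitP => j ij; rewrite !mxE.
      rewrite (ord1 j) eqxx mulr1n /X; congr (Z _ w); apply/val_inj.
        by rewrite /= ij ord1.
    by congr (Z _ w); exact/val_inj.
  rewrite !qformD !qformN !qform_col_mx ?trmx1//.
  have -> : (1%:M : 'M[R]_(1 + m)) 0 0 = 1 by rewrite mxE eqxx.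
  have -> : dlsubmx (1%:M : 'M[R]_(1 + m)) = 0.
    by rewrite scalar_mx_block block_mxKdl.
  have -> : drsubmx (1%:M : 'M[R]_(1 + m)) = 1%:M.
    by rewrite scalar_mx_block block_mxKdr.
  rewrite trmx0 mul0mx -/(W w) [(0 : 'M[R]_1) 0 0]mxE.
  ring.
rewrite (integral_independent mG GI GT XG)//; last first.
  by move=> z; rewrite lee_fin expR_ge0.
transitivity (\int[P]_w ((A 0 0 `^ (- 2^-1))%:E *
  (expR (- 2^-1 * qform (schur A - 1%:M) (\col_i Y i w)))%:E))%E.
  apply: eq_integral => w _.
  transitivity (\int[normal_prob 0 1]_u F (u, w))%E.
    apply: (integral_std_gaussian (gZ ord0)).
      exact: measurable_fun_pair1 mF.
    by move=> u; rewrite /F lee_fin expR_ge0.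
  set Q := qform (drsubmx A - 1%:M) (V w).
  transitivity (\int[normal_prob 0 1]_u ((expR (- 2^-1 * Q))%:E *
      (expR (- 2^-1 * ((A 0 0 - 1) * u ^+ 2 + 2 * W w * u)))%:E))%E.
    by apply: eq_integral => u _; rewrite /F/= -EFinM -expRD addrC mulrDr.
  rewrite ge0_integralZl//=; last exact: measurable_expR_quadratic.
  rewrite integral_normal_prob_expR_quadratic// -!EFinM; congr _%:E.
  (* The exponent W^2 / (2 A_00) produced by the inner integral corrects the form of [drsubmx A]
     into that of the Schur complement. *)
  rewrite mulrCA -expRD; congr (_ * expR _).
  rewrite /Q (qformD (schur A)) qform_schur (qformD (drsubmx A)) qformN.
  rewrite -/(W w); field.
  by rewrite gt_eqF.
rewrite ge0_integralZl//; first last.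
- by rewrite lee_fin powR_ge0.
- apply/measurable_EFinP; apply: measurableT_comp => //.
  apply: measurable_funM => //; apply: measurable_qform => i.
  by under eq_fun do rewrite mxE; exact: measurable_funPT.
rewrite (IHm Y _ (fun i => gZ (lift ord0 i)) YE (posdef_schur pA)).
rewrite -EFinM -powRM ?ltW ?posdef_det_gt0//; last exact: posdef_schur.
by rewrite -det_schur// gt_eqF.
Qed.

End gaussian_vector.

(** * The matrix K_n *)

Lemma bilinear_form_sum (R : comNzRingType) m (A : 'M[R]_m) (x y : 'cV[R]_m) :
  (x^T *m A *m y) 0 0 = \sum_j \sum_k A j k * (x j 0 * y k 0).
Proof.
rewrite mxE exchange_big/=; apply: eq_bigr => k _.
by rewrite mxE big_distrl/=; apply: eq_bigr => j _; rewrite mxE; ring.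
Qed.

Section bridge_covariance.
Context {R : realType}.
Implicit Types (n : nat) (x y : nat -> R).

Lemma sum_leq_indicator n j :
  \sum_(i < n) (j <= i)%:R = (n - j)%:R :> R.
Proof.
elim: n => [|n IHn]; first by rewrite big_ord0.
rewrite big_ord_recr/= IHn; case: leqP => jn; last first.
  by rewrite addr0; congr (_%:R); lia.
by rewrite subSn// -natr1.
Qed.

(** The left side is the coefficient of [x j * y k] in the empirical covariance of the partial sums;
    the identity rests on min + max = j + k. *)
Lemma bridge_cov n j k : (0 < n)%N -> (j <= n)%N -> (k <= n)%N ->
  n%:R^-1 * (n - maxn j k)%:R - (n%:R ^+ 2)^-1 * ((n - j)%:R * (n - k)%:R) =
  (minn j k)%:R / n%:R - j%:R * k%:R / n%:R ^+ 2 :> R.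
Proof.
move=> n0 jn kn; have n0' : n%:R != 0 :> R by rewrite pnatr_eq0 -lt0n.
by rewrite !natrB ?geq_max ?jn//; case: leqP => jk; field.
Qed.

Lemma cov_partial_sums n x y : (0 < n)%N ->
  n%:R^-1 * (\sum_(1 <= i < n.+1) (\sum_(j < i) x j) * (\sum_(j < i) y j))
  - (n%:R ^+ 2)^-1 * ((\sum_(1 <= i < n.+1) \sum_(j < i) x j)
                      * (\sum_(1 <= i < n.+1) \sum_(j < i) y j)) =
  \sum_(j < n.-1) \sum_(k < n.-1) Kmx R n j k * (x j.+1 * y k.+1).
Proof.
move=> n0.
have psum (z : nat -> R) i : (i < n)%N ->
    \sum_(j < i.+1) z j = \sum_(j < n) (j <= i)%:R * z j :> R.
  move=> ni; rewrite (big_ord_widen n)// big_mkcond/=; apply: eq_bigr => j _.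
  by rewrite ltnS; case: leqP => _; rewrite ?mul1r ?mul0r.
have Sx (z : nat -> R) : \sum_(1 <= i < n.+1) \sum_(j < i) z j =
    \sum_(j < n) (n - j)%:R * z j :> R.
  rewrite big_add1 big_mkord; under eq_bigr => i _ do rewrite psum//.
  rewrite exchange_big; apply: eq_bigr => j _.
  by rewrite -big_distrl/= sum_leq_indicator.
have Sxy : \sum_(1 <= i < n.+1) (\sum_(j < i) x j) * (\sum_(j < i) y j) =
    \sum_(j < n) \sum_(k < n) (n - maxn j k)%:R * (x j * y k) :> R.
  rewrite big_add1 big_mkord.
  under eq_bigr => i _ do rewrite !psum// big_distrlr/=.
  rewrite exchange_big; apply: eq_bigr => j _.
  rewrite exchange_big; apply: eq_bigr => k _.
  rewrite -sum_leq_indicator big_distrl/=; apply: eq_bigr => i _.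
  by rewrite geq_max; case: leqP => _; case: leqP => _ /=; ring.
rewrite Sxy !Sx big_distrlr/= !big_distrr -sumrB/=.
transitivity (\sum_(j < n) \sum_(k < n)
    ((minn j k)%:R / n%:R - j%:R * k%:R / n%:R ^+ 2) * (x j * y k)).
  apply: eq_bigr => j _; rewrite !big_distrr -sumrB/=; apply: eq_bigr => k _.
  rewrite -(bridge_cov n0 (ltnW (ltn_ord j)) (ltnW (ltn_ord k))); ring.
(* The kernel vanishes when either index is 0, so [x 0] and [y 0] drop out and the other indices
   shift by one. *)
case: n n0 {psum Sx Sxy} => // n _.
rewrite big_ord_recl big1 ?add0r => [|k _]; last by rewrite /= min0n; ring.
apply: eq_bigr => j _.
rewrite big_ord_recl /= minn0 !mul0r mulr0 mul0r subrr mul0r add0r.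
by apply: eq_bigr => k _; rewrite mxE.
Qed.

(* [n K_n] is the Gram matrix of the centred indicators [i |-> 1_(j <= i)]. *)
Lemma Kmx_gram n : (0 < n)%N ->
  let B := \matrix_(i < n, j < n.-1)
    ((j.+1 <= i)%:R - (n - j.+1)%:R / n%:R : R) in
  Kmx R n = n%:R^-1 *: (B^T *m B).
Proof.
move=> n0 B; apply/matrixP => j k; rewrite !mxE.
have n0' : n%:R != 0 :> R by rewrite pnatr_eq0 -lt0n.
have jn (i : 'I_n.-1) : (i.+1 <= n)%N by have := ltn_ord i; lia.
rewrite -bridge_cov//.
(* The means of the two indicators, whose product is the indicator attached to the larger index. *)
pose p : R := (n - j.+1)%:R / n%:R; pose q : R := (n - k.+1)%:R / n%:R.
transitivity (n%:R^-1 * \sum_(i < n) ((maxn j.+1 k.+1 <= i)%:R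
    + - q * (j.+1 <= i)%:R + - p * (k.+1 <= i)%:R + p * q) : R).
  rewrite !big_split/= -!mulr_sumr !sum_leq_indicator sumr_const card_ord.
  rewrite -[_ *+ n]mulr_natr /p /q; move: (_ - maxn _ _)%N => M.
  by field.
congr (_ * _); apply: eq_bigr => i _; rewrite !mxE geq_max.
by case: leqP => _; case: leqP => _ /=; rewrite /p /q; ring.
Qed.

Lemma Kmx_sym n : (Kmx R n)^T = Kmx R n.
Proof. by apply/matrixP => j k; rewrite !mxE minnC (mulrC (k.+1)%:R). Qed.

End bridge_covariance.

(** * The quadratic form of S (x) K_n: positivity and determinant *)

Section quadratic_form_K.
Context {R : realType} (s11 s12 s22 : R).
Hypotheses (s11_ge0 : 0 <= s11) (s22_ge0 : 0 <= s22)
  (s12_le : s12 ^+ 2 <= s11 * s22).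

Definition Smx n : 'M[R]_(n.-1 + n.-1) :=
  block_mx (s11 *: Kmx R n) (s12 *: Kmx R n) (s12 *: Kmx R n) (s22 *: Kmx R n).

Lemma Smx_sym n : (Smx n)^T = Smx n.
Proof. by rewrite /Smx tr_block_mx !linearZ/= Kmx_sym. Qed.

Lemma qform_Smx n (u v : 'cV[R]_n.-1) :
  qform (Smx n) (col_mx u v) =
  s11 * (u^T *m Kmx R n *m u) 0 0 + 2 * s12 * (u^T *m Kmx R n *m v) 0 0
  + s22 * (v^T *m Kmx R n *m v) 0 0.
Proof.
have vu : (v^T *m Kmx R n *m u) 0 0 = (u^T *m Kmx R n *m v) 0 0.
  by rewrite -[_ *m u]trmxK mxE !trmx_mul trmxK Kmx_sym mulmxA.
rewrite /qform tr_col_mx mul_row_block mul_row_col !mulmxDl.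
rewrite -!scalemxAr -!scalemxAl; move: vu.
move: (_ *m u) (_ *m u) (_ *m v) (_ *m v) => uu vu uv vv vuE.
by rewrite !mxE vuE; ring.
Qed.

(** Multiplication by [s11] completes the square; if [s11] is 0, the bound on [s12] forces [s12] to
    be 0. *)
Lemma quadratic_ge0 (a b : R) :
  0 <= s11 * a ^+ 2 + 2 * s12 * (a * b) + s22 * b ^+ 2.
Proof.
have [s11_0|] := eqVneq s11 0.
  move: s12_le; rewrite s11_0 mul0r => s12_0.
  have /eqP -> : s12 == 0 by rewrite -sqrf_eq0 eq_le s12_0 sqr_ge0.
  by rewrite mul0r mulr0 mul0r !add0r mulr_ge0 ?sqr_ge0.
move=> s11_0; have s11_gt0 : 0 < s11 by rewrite lt_def s11_0.
rewrite -(pmulr_rge0 _ s11_gt0).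
rewrite [leRHS](_ : _ =
  (s11 * a + s12 * b) ^+ 2 + (s11 * s22 - s12 ^+ 2) * b ^+ 2).
  by rewrite addr_ge0 ?sqr_ge0// mulr_ge0 ?sqr_ge0// subr_ge0.
ring.
Qed.

(** By the Gram factorization of K_n, the form is an average over [i] of the two-variable form of S
    at the [i]-th entries of B u and B v. *)
Lemma qform_Smx_ge0 n x : (0 < n)%N -> 0 <= qform (Smx n) x.
Proof.
move=> n0; rewrite -[x]vsubmxK qform_Smx (Kmx_gram n0).
set B := \matrix_(_, _) _; set u := usubmx x; set v := dsubmx x.
have E (y z : 'cV[R]_n.-1) : (y^T *m (n%:R^-1 *: (B^T *m B)) *m z) 0 0 =
    n%:R^-1 * \sum_i (B *m y) i 0 * (B *m z) i 0.
  rewrite -scalemxAr -scalemxAl mxE mulmxA -trmx_mul -mulmxA; congr (_ * _).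
  by rewrite mxE; apply: eq_bigr => i _; rewrite [_^T _ _]mxE.
rewrite !E !(mulrCA _ n%:R^-1) -!mulrDr mulr_ge0 ?invr_ge0//.
rewrite !mulr_sumr -!big_split/= sumr_ge0// => i _.
by have := quadratic_ge0 ((B *m u) i 0) ((B *m v) i 0); rewrite !expr2.
Qed.

Lemma posdef_Smx n : (0 < n)%N -> posdef (1%:M + Smx n).
Proof.
by move=> n0; apply: posdef_add1 => [|x]; [exact: Smx_sym|exact: qform_Smx_ge0].
Qed.

Lemma det_Smx n : (0 < n)%N ->
  \det (1%:M + Smx n) =
  dn n (alpha s11 s12 s22) * dn n (beta s11 s12 s22).
Proof.
move=> n0; set K := Kmx R n.
(* Block elimination needs an invertible corner; this one is positive definite. *)
have uA : 1%:M + s11 *: K \in unitmx.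
  have [u_sym u_pos] : posdef (1%:M + s11 *: K).
    apply: posdef_add1 => [|y]; first by rewrite linearZ/= Kmx_sym.
    rewrite /qform -scalemxAr -scalemxAl mxE mulr_ge0// /K (Kmx_gram n0).
    set B := \matrix_(_, _) _.
    rewrite -scalemxAr -scalemxAl mxE mulmxA -trmx_mul -mulmxA mxE.
    rewrite mulr_ge0 ?invr_ge0// sumr_ge0// => i _.
    by rewrite mxE -expr2 sqr_ge0.
  by rewrite unitmxE unitfE gt_eqF// posdef_det_gt0.
rewrite /Smx scalar_mx_block add_block_mx !add0r det_block_comm//; last first.
  rewrite mulmxDl mulmxDr mul1mx mulmx1 -!scalemxAr -!scalemxAl !scalerA.
  by rewrite mulrC.
rewrite /dn -det_mulmx; congr (\det _); rewrite -/K.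
set a := alpha _ _ _; set b := beta _ _ _.
(* [a] and [b] are the negated eigenvalues of S: their sum is minus its trace, their product its
   determinant. *)
have ab : a + b = - (s11 + s22) by rewrite /a /b /alpha /beta; field.
have abM : a * b = s11 * s22 - s12 ^+ 2.
  have := @sqr_sqrtr R ((s11 - s22) ^+ 2 + 4 * s12 ^+ 2).
  rewrite /a /b /alpha /beta; set r := Num.sqrt _ => H.
  have : r ^+ 2 = (s11 - s22) ^+ 2 + 4 * s12 ^+ 2.
    by apply: H; rewrite addr_ge0 ?sqr_ge0// mulr_ge0 ?sqr_ge0 ?ler0n.
  move=> rE; transitivity (((s11 + s22) ^+ 2 - r ^+ 2) / 4); first by field.
  by rewrite rE; field.
rewrite !(mulmxDl, mulmxDr, mulmxN, mulNmx, mul1mx, mulmx1).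
rewrite -!scalemxAl -!scalemxAr !scalerA.
(* Once [s11 * s22] and [b] are eliminated, both sides agree entrywise, with K^2 treated as an
   opaque matrix. *)
have -> : s11 * s22 = a * b + s12 ^+ 2 by rewrite abM; ring.
have -> : b = - (s11 + s22) - a by rewrite -ab; ring.
move: (K *m K) (K) => L K'; apply/matrixP => i j.
by rewrite !mxE; ring.
Qed.

End quadratic_form_K.

(** * Joint independence of finitely many terms of the two sequences *)

Section independence.
Context d (T : measurableType d) (R : realType) (P : probability T R).

Lemma mutually_independent_fin (X : nat -> {RV P >-> R}) m (f : 'I_m -> nat) :
  mutually_independent X -> injective f ->
  fin_mutually_independent (fun i => X (f i)).
Proof.
move=> iX f_inj B mB.
(* Transports [B] along the injection [f]; the default [setT] imposes no constraint. *)
pose B' k := if [pick i | f i == k] is Some i then B i else setT.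
have B'f i : B' (f i) = B i.
  by rewrite /B'; case: pickP => [j /eqP/f_inj -> //|/(_ i)]; rewrite eqxx.
have mB' k : measurable (B' k) by rewrite /B'; case: pickP.
have := iX [fset f i | i in 'I_m]%fset B' mB'.
rewrite (perm_big _ (enum_imfset _ (in2W f_inj))) big_map big_enum/=.
under eq_bigr do rewrite B'f.
move=> <-; congr (P _); apply/seteqP; split => [w Bw k|w Bw i].
  by move=> /= /imfsetP[i _ ->]; rewrite B'f.
by have := Bw (f i); rewrite B'f; apply; apply/imfsetP; exists i.
Qed.

(** The successors skip the first term of each sequence, which K_n does not see. *)
Definition pair_seq (X Y : nat -> {RV P >-> R}) m n (i : 'I_(m + n)) :
    {RV P >-> R} :=
  match fintype.split i with inl j => X j.+1 | inr k => Y k.+1 end.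

Lemma sigma_seq_bigcap (X : nat -> {RV P >-> R}) m (f : 'I_m -> nat)
    (B : 'I_m -> set R) : (forall i, measurable (B i)) ->
  sigma_seq X [set w | forall i, B i (X (f i) w)].
Proof.
move=> mB; rewrite (_ : mkset _ = \big[setI/setT]_i (X (f i) @^-1` B i)).
  elim/big_ind: _ => [|U V|i _].
  - exact: (@measurableT _ (g_sigma_algebraType _)).
  - exact: (@measurableI _ (g_sigma_algebraType _)).
  - apply: sub_sigma_algebra; exists (f i) => //.
    by exists (B i) => //; rewrite setTI.
apply/seteqP; split => [w Bw|w].
  by elim/big_ind: _ => [|U V ? ?|i _]; [|split|exact: Bw].
by move=> + i; rewrite (bigD1 i)//= => -[].
Qed.

(** A joint event is the intersection of an event of [sigma_seq X] and one of [sigma_seq Y]; each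
    then factors within its own sequence. *)
Lemma pair_seq_independent (X Y : nat -> {RV P >-> R}) m n :
  mutually_independent X -> mutually_independent Y ->
  independent_sequences X Y ->
  fin_mutually_independent (pair_seq X Y (m := m) (n := n)).
Proof.
move=> iX iY iXY B mB.
have S_inj p : injective (fun i : 'I_p => i.+1) by move=> i j [] /val_inj.
have pl i : pair_seq X Y (lshift n i) = X i.+1.
  by rewrite /pair_seq (unsplitK (inl i)).
have pr i : pair_seq X Y (rshift m i) = Y i.+1.
  by rewrite /pair_seq (unsplitK (inr i)).
rewrite big_split_ord/=.
under eq_bigr do rewrite pl.
under [X in (_ * X)%E]eq_bigr do rewrite pr.
rewrite -(mutually_independent_fin iX (@S_inj m) (fun i => mB (lshift n i))).
rewrite -(mutually_independent_fin iY (@S_inj n) (fun i => mB (rshift m i))).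
rewrite -iXY; last 2 first.
- exact: (@sigma_seq_bigcap X m (fun i => i.+1) _ (fun i => mB (lshift n i))).
- exact: (@sigma_seq_bigcap Y n (fun i => i.+1) _ (fun i => mB (rshift m i))).
congr (P _); apply/seteqP; split => [w Bw|w [BX BY] i].
  by split=> i; [rewrite -pl|rewrite -pr]; exact: Bw.
by rewrite -[i]splitK; case: (fintype.split i) => j /=; rewrite ?pl ?pr.
Qed.

End independence.

(** * Evaluation of the joint moment generating function *)

Lemma Zstat_Kmx d (T : measurableType d) (R : realType) (P : probability T R)
    n (X Y : nat -> {RV P >-> R}) w : (0 < n)%N ->
  Zstat n X Y w =
  \sum_(j < n.-1) \sum_(k < n.-1) Kmx R n j k * (X j.+1 w * Y k.+1 w).
Proof. exact: (cov_partial_sums (X^~ w) (Y^~ w)). Qed.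

Theorem theorem2 (d : measure_display) (T : measurableType d) (R : realType)
    (P : probability T R) (X Y : nat -> {RV P >-> R})
    (gaussX : forall k, std_gaussian (X k))
    (gaussY : forall k, std_gaussian (Y k))
    (indepX : mutually_independent X)
    (indepY : mutually_independent Y)
    (indepXY : independent_sequences X Y)
    (n : nat) (n_ge2 : (2 <= n)%N)
    (s11 s12 s22 : R) (s11_ge0 : 0 <= s11) (s22_ge0 : 0 <= s22)
    (s12_le : s12 ^+ 2 <= s11 * s22) :
  phi n X Y s11 s12 s22 =
  ((dn n (alpha s11 s12 s22) * dn n (beta s11 s12 s22)) `^ (- 2^-1))%:E.
Proof.
have n0 : (0 < n)%N by exact: ltnW.
pose Z := pair_seq X Y (m := n.-1) (n := n.-1).
(* The Gaussian formula is used with A = I + S (x) K_n, so that A - I is the matrix of the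
   exponent. *)
rewrite -det_Smx// -(integral_gaussian_qform (Z := Z)).
- rewrite /phi unlock; apply: eq_integral => w _.
  rewrite (addrC 1%:M) addrK; congr (expR (_ * _))%:E.
  have -> : \col_i Z i w = col_mx (\col_j X j.+1 w) (\col_j Y j.+1 w).
    apply/colP => i; rewrite !mxE /Z /pair_seq.
    by case: (fintype.split i) => j; rewrite mxE.
  rewrite qform_Smx !bilinear_form_sum !Zstat_Kmx//.
  congr (_ * _ + _ * _ + _ * _); apply: eq_bigr => j _; apply: eq_bigr => k _;
    by rewrite !mxE.
- by move=> i; rewrite /Z /pair_seq; case: fintype.split.
- exact: pair_seq_independent.
- exact: posdef_Smx.
Qed.
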